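(* Consider the chance constrained program with an uncertain linear equality, $$v^*=\min_{x\in\mathcal X}\{c^\top x:\ \mathbb P\{\tilde\xi^\top(Ax)+a(\tilde\xi)=b^\top x\}\ge 1-\varepsilon\},\qquad \mathcal X=\{x\in\mathbb R^n:U^\top x=h\},$$ and, for $t\in\mathbb R$ and measurable $a:\Xi\to\mathbb R$, its hinge-loss approximation $$\min_{x\in\mathcal X,\ s(\cdot)}\{\mathbb E[|s(\tilde\xi)|]:\ \tilde\xi^\top(Ax)+a(\tilde\xi)-b^\top x=s(\tilde\xi),\ c^\top x=t\}.\qquad(\mathrm H_{t,a})$$ Then: (i) The generalized nullspace property holds if and only if the following is true: for every pair $(t,a(\cdot))$ for which $(\mathrm H_{t,a})$ has a feasible solution $(x,s(\cdot))$ with $\mathbb P\{s(\tilde\xi)=0\}\ge 1-\varepsilon$, all optimal solutions $(x^*,s^*(\cdot))$ of $(\mathrm H_{t,a})$ share the same $s^*(\cdot)$ and satisfy $\mathbb P\{s^*(\tilde\xi)=0\}\ge1-\varepsilon$. (ii) If the generalized nullspace property holds, then the optimal value $v^A$ of the corresponding ALSO-X problem equals $v^*$; moreover, all optimal solutions $x^*$ of the chance constrained program share the same $s^*(\cdot)$, where $s^*(\xi)=\xi^\top(Ax^* )+a(\xi)-b^\top x^*$.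
   Context: Setting. $\tilde\xi$ is a random vector on a probability space with law $\mathbb P$ and support $\Xi\subseteq\mathbb R^m$; $\varepsilon\in(0,1)$; $A\in\mathbb R^{m\times n}$, $b,c\in\mathbb R^n$; $U$ is a matrix with $n$ rows and $h$ a vector of matching dimension; $\mathcal X$ is nonempty. $s(\cdot)$ ranges over measurable functions $\Xi\to\mathbb R$; equalities between functions of $\tilde\xi$ and constraints hold almost surely. Expectations appearing are assumed finite, and the chance constrained program is assumed to be feasible with an optimal solution. Generalized nullspace property: for every $(x,s(\cdot))$ such that $\xi^\top(Ax)-b^\top x-s(\xi)=0$, $c^\top x=0$, $U^\top x=0$ and $s(\cdot)\ne0$ (i.e. $s$ is not almost surely zero), and for every $\mathbb P$-measurable set $\mathcal S\subseteq\Xi$ with $\mathbb P\{\tilde\xi\in\mathcal S\}\le\varepsilon$, one has $\mathbb E[|s(\tilde\xi)|\,\mathbb I(\tilde\xi\in\mathcal S)]<\tfrac12\mathbb E[|s(\tilde\xi)|]$. ALSO-X for this problem (for the given $a$): $$v^A=\min_t\{t:\ (x^*,s^*(\cdot))\text{ optimal for }(\mathrm H_{t,a}),\ \mathbb P\{s^*(\tilde\xi)=0\}\ge1-\varepsilon\}.$$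
   Formalization: In (i) the shared s* of all optimal solutions is required to equal (a.s.) the s of every feasible solution with P{s=0} ≥ 1-ε; with mere mutual equality of the s* the converse is false (ξ uniform on {0,1}, A=1, b=c=0, no U, ε=1/2). *)

(* Defs.v *)
From HB Require Import structures.
From mathcomp Require Import all_boot all_order all_algebra.
From mathcomp Require Import all_classical all_reals all_analysis.

Set Implicit Arguments.
Unset Strict Implicit.
Unset Printing Implicit Defensive.

Import Order.TTheory GRing.Theory Num.Theory.
Import numFieldNormedType.Exports.

Local Open Scope classical_set_scope.
Local Open Scope ring_scope.

(* R^m, as column vectors, with its Borel sigma-algebra. *)
Definition borel_cV (R : realType) (m : nat) :=
  g_sigma_algebraType (@open 'cV[R]_m).

Definition dotp (R : realType) (k : nat) (u v : 'cV[R]_k) : R :=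
  (u^T *m v) ord0 ord0.

Definition supp (R : realType) (m : nat)
    (P : probability (borel_cV R m) R) : set (borel_cV R m) :=
  [set u | forall V : set 'cV[R]_m, open V -> V u -> (0 < P V)%E].

Definition is_min (R : realType) (E : set R) (v : R) : Prop :=
  E v /\ lbound E v.

(* Functions on the support Xi of the law P are encoded as functions on R^m of
   which only the restriction to Xi matters: measurability, integrals,
   probabilities and almost sure equalities are all relative to Xi. *)
Section chance_constrained.
Variables (R : realType) (m n p : nat).
Variable P : probability (borel_cV R m) R.
Variables (A : 'M[R]_(m, n)) (b c : 'cV[R]_n).
Variables (U : 'M[R]_(n, p)) (h : 'cV[R]_p) (eps : R).

Local Notation Xi := (supp P).
Local Notation rfun := (borel_cV R m -> R).

Definition mean_abs (s : rfun) : \bar R :=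
  (\int[P]_(u in Xi) `|s u|%:E)%E.

Definition mostly_zero (s : rfun) : Prop :=
  ((1 - eps)%:E <= P (Xi `&` [set u | s u = 0%R]))%E.

Definition residual (a : rfun) (x : 'cV[R]_n) : rfun :=
  fun u => dotp u (A *m x) + a u - dotp b x.

(* The pairs (x, s) over which the nullspace property quantifies, before the
   requirement that s be nonzero. *)
Definition null_pair (x : 'cV[R]_n) (s : rfun) : Prop :=
  [/\ measurable_fun Xi s,
      ae_eq P Xi (fun u => dotp u (A *m x) - dotp b x - s u) (cst 0),
      dotp c x = 0 & U^T *m x = 0].

Definition nullspace_property : Prop :=
  forall (x : 'cV[R]_n) (s : rfun),
    null_pair x s -> ~ ae_eq P Xi s (cst 0) ->
  forall S : set (borel_cV R m),
    measurable S -> S `<=` Xi -> (P S <= eps%:E)%E ->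
    (\int[P]_(u in S) `|s u|%:E < 2^-1%:E * mean_abs s)%E.

Definition hinge_feasible (t : R) (a : rfun) (x : 'cV[R]_n) (s : rfun) : Prop :=
  [/\ measurable_fun Xi s, U^T *m x = h,
      ae_eq P Xi (residual a x) s & dotp c x = t].

Definition hinge_optimal (t : R) (a : rfun) (x : 'cV[R]_n) (s : rfun) : Prop :=
  hinge_feasible t a x s /\
  forall x' s', hinge_feasible t a x' s' -> (mean_abs s <= mean_abs s')%E.

Definition hinge_finite (t : R) (a : rfun) : Prop :=
  forall x s, hinge_feasible t a x s -> (mean_abs s < +oo)%E.

(* The common function s of the optimal solutions is the one carried by the
   feasible solution that vanishes with probability at least 1 - eps.  Merely
   asking the optimal s' to coincide with each other and to vanish with
   probability at least 1 - eps is too weak to imply the nullspace property: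
   let xi be uniform on {0, 1} with m = n = 1, A = 1, b = c = 0, no constraint
   U, and eps = 1/2; the only optimal s' is then (a 0, 0) on {0, 1}. *)
Definition exact_recovery : Prop :=
  forall (t : R) (a : rfun), measurable_fun Xi a -> hinge_finite t a ->
  forall x s, hinge_feasible t a x s -> mostly_zero s ->
  forall x' s', hinge_optimal t a x' s' -> ae_eq P Xi s' s /\ mostly_zero s'.

Definition ccp_feasible (a : rfun) : set 'cV[R]_n :=
  [set x | U^T *m x = h /\
    ((1 - eps)%:E <=
     P (Xi `&` [set u | (dotp u (A *m x) + a u = dotp b x)%R]))%E].

Definition ccp_values (a : rfun) : set R :=
  [set dotp c x | x in ccp_feasible a].

Definition ccp_optimal (a : rfun) (x : 'cV[R]_n) : Prop :=
  ccp_feasible a x /\ lbound (ccp_values a) (dotp c x).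

Definition alsox_values (a : rfun) : set R :=
  [set t | exists x s, hinge_optimal t a x s /\ mostly_zero s].

End chance_constrained.

(* Main.v *)
(* Two feasible points of the hinge-loss problem differ by a pair of the
   nullspace property.  If s is feasible and vanishes off a set S of probability
   at most eps, and s' is another feasible function, then E|s'| - E|s| is at
   least the mass of s' - s off S minus its mass on S, which is positive: hence
   s is the unique minimizer.  This gives recovery, and part (ii), since the
   residuals of points feasible for the chance constraint are such functions.
   Conversely, a pair violating the property is cut into two feasible functions
   on S and off S, both minimizers once recovery applies to the former; recovery
   says something only about minimizers, so one must know that a minimizer
   exists, i.e. that a seminorm attains its minimum on a finite-dimensional
   affine space. *)
Require Import Defs.
From HB Require Import structures.
From mathcomp Require Import all_boot all_order all_algebra.
From mathcomp Require Import all_classical all_reals all_analysis.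
From mathcomp Require Import measurable_realfun ring lra.

Set Implicit Arguments.
Unset Strict Implicit.
Unset Printing Implicit Defensive.

Import Order.TTheory GRing.Theory Num.Theory.
Import numFieldNormedType.Exports.

Local Open Scope classical_set_scope.
Local Open Scope ring_scope.

(** * Borel probabilities on [R^m] and their support *)

Section support.
Variables (R : realType) (m : nat) (P : probability (borel_cV R m) R).

(** Rational centres and radii [1/(k+1)] give only countably many boxes, so a countable union can
    replace the union of all null open sets. *)
Lemma rational_box (V : set 'cV[R]_m) (u : 'cV[R]_m) : open V -> V u ->
  exists (q : 'cV[rat]_m) (k : nat),
    (forall i, `|u i 0 - ratr (q i 0)| < k.+1%:R^-1) /\
    (forall w : 'cV[R]_m,
       (forall i, `|w i 0 - ratr (q i 0)| < k.+1%:R^-1) -> V w).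
Proof.
move=> oV Vu.
have /nbhs_ballP[e /= e0 eV] : nbhs u V by exact: open_nbhs_nbhs.
(* Half of [e], because [u] and [w] both lie within the radius of [q] and the triangle inequality
   adds the two distances. *)
have [k ke] : exists k : nat, k.+1%:R^-1 < e / 2.
  have e20 : 0 < e / 2 by rewrite divr_gt0.
  exists (Num.bound (e / 2)^-1).
  rewrite -[ltRHS]invrK ltf_pV2 ?posrE ?invr_gt0//.
  rewrite (lt_trans (archi_boundP _)) ?invr_ge0 ?(ltW e20)//.
  by rewrite ltr_nat.
have k0 : (0 : R) < k.+1%:R^-1 by rewrite invr_gt0.
suff [q [uq qV]] : exists q : 'cV[rat]_m,
    (forall i, `|u i 0 - ratr (q i 0)| < k.+1%:R^-1) /\
    (forall w : 'cV[R]_m,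
       (forall i, `|w i 0 - ratr (q i 0)| < k.+1%:R^-1) -> V w).
  by exists q, k.
move: (k.+1%:R^-1) ke k0 => d de d0.
have /choice[q qE] : forall i : 'I_m,
    exists r : rat, `|u i 0 - ratr r| < d.
  move=> i.
  have [|r] := @rat_in_itvoo R (u i 0 - d) (u i 0 + d).
    by lra.
  rewrite in_itv/= => /andP[r1 r2]; exists r; rewrite ltr_norml; lra.
exists (\col_i q i); split=> [i|w wq]; first by rewrite mxE.
apply: eV; split=> // i j; rewrite ord1 /ball/=.
have := qE i; have := wq i; rewrite mxE !ltr_norml => /andP[? ?] /andP[? ?].
lra.
Qed.

Lemma measurable_supp : measurable (supp P).
Proof.
rewrite -[supp P]setCK; apply: measurableC; apply: sub_sigma_algebra.
rewrite (_ : ~` supp P =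
    \bigcup_(V in [set V : set 'cV[R]_m | open V /\ ~ (0 < P V)%E]) V).
  by apply: bigcup_open => V [].
apply/seteqP; split=> [u|u [V [oV PV] Vu]].
  rewrite /supp /= => /existsNP[V /not_implyP[oV /not_implyP[Vu PV]]].
  by exists V.
by move=> /(_ V oV Vu).
Qed.

(** Every point off the support lies in a rational box inside a null open set, so countably many
    negligible boxes cover the complement. *)
Lemma probability_supp : P (supp P) = 1%E.
Proof.
have mS := measurable_supp.
pose O (q : 'cV[rat]_m) (k : nat) : set (borel_cV R m) :=
  [set u | forall i, `|u i 0 - ratr (q i 0)| < k.+1%:R^-1].
(* Enumerates the negligible boxes by the codes of [(q, k)]; all other indices contribute the empty
   set. *)
pose F (l : nat) : set (borel_cV R m) :=
  if unpickle l is Some (q, k) then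
    if `[< P.-negligible (O q k) >] then O q k else set0
  else set0.
have nF : P.-negligible (\bigcup_l F l).
  apply: negligible_bigcup => l; rewrite /F.
  case: (unpickle l) => [[q k]|]; last exact: negligible_set0.
  by case: ifPn => [/asboolP//|_]; exact: negligible_set0.
have /(negligibleP P (measurableC mS)) : P.-negligible (~` supp P).
  apply: negligibleS nF => u.
  rewrite /supp /= => /existsNP[V /not_implyP[oV /not_implyP[Vu PV]]].
  have [q [k [uq qV]]] := rational_box oV Vu.
  exists (pickle (q, k)) => //; rewrite /F pickleK ifT//.
  apply/asboolP; exists V; split.
  - exact: sub_sigma_algebra.
  - by apply/eqP; rewrite eq_le measure_ge0 andbT leNgt; apply/negP.
  - exact: qV.
move: (probability_setC P mS) => PC P0; move: (etrans (esym PC) P0) => /eqP.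
by rewrite sube_eq ?fin_num_measure// add0e => /eqP.
Qed.

Lemma measurable_coord (i : 'I_m) :
  measurable_fun [set: borel_cV R m] (fun u : borel_cV R m => u i 0 : R).
Proof.
apply: (measurability _ (RGenOpens.measurableE R)) => _ [_ [a [b ->] <-]].
rewrite setTI; apply: sub_sigma_algebra.
have /continuousP := @coord_continuous R m 1 i 0.
by apply; exact: interval_open.
Qed.

Lemma measurable_dotp (v : 'cV[R]_m) :
  measurable_fun [set: borel_cV R m] (fun u : borel_cV R m => dotp u v).
Proof.
rewrite /dotp (_ : (fun _ => _) =
    fun u : borel_cV R m => \sum_i (u i 0 * v i 0)).
  apply: measurable_sum => i; apply: measurable_funM; last exact: measurable_cst.
  exact: measurable_coord.
by apply/funext => u; rewrite mxE; apply: eq_bigr => i _; rewrite mxE.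
Qed.

End support.

(** * Minima of seminorms on finite-dimensional affine spaces *)

Section seminorm.
Variable R : realType.

Definition seminorm (V : lmodType R) (N : V -> R) : Prop :=
  (forall x y, N (x + y) <= N x + N y) /\ forall r x, N (r *: x) = `|r| * N x.

Lemma seminorm_ge0 (V : lmodType R) (N : V -> R) :
  seminorm N -> forall x, 0 <= N x.
Proof.
move=> [ND NZ] x; have := ND x (- 1 *: x); rewrite NZ normrN1 mul1r.
by rewrite scaleN1r subrr -(scale0r x) NZ normr0 mul0r; lra.
Qed.

(** Along the line the function is Lipschitz with constant [N v]. If [N v] is zero it is constant;
    otherwise it is coercive, and the extreme value theorem on a compact interval suffices. *)
Lemma seminorm_line_min (V : lmodType R) (N : V -> R) : seminorm N ->
  forall x v : V, exists r : R, forall r', N (x + r *: v) <= N (x + r' *: v).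
Proof.
move=> sN x v; have N0 := seminorm_ge0 sN; have [ND NZ] := sN.
pose f r := N (x + r *: v).
have lip r r' : f r <= f r' + `|r - r'| * N v.
  rewrite -NZ (le_trans _ (ND _ _))// -addrA -scalerDl (addrC r') subrK//.
have [v0|v0] := eqVneq (N v) 0.
  by exists 0 => r'; have := lip 0 r'; rewrite v0 mulr0 addr0.
have v0' : 0 < N v by rewrite lt_def v0 N0.
have cf : continuous f.
  move=> r; apply/cvgrPdist_le => e e0.
  near=> r'.
  have h : `|r - r'| <= e / N v.
    near: r'; apply: cvgr_dist_le; first exact: cvg_id.
    by rewrite divr_gt0.
  have : `|r - r'| * N v <= e by rewrite -ler_pdivlMr.
  have := lip r r'; have := lip r' r; rewrite (distrC r') ler_norml.
  by move=> *; apply/andP; split; lra.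
(* Since [|r| * N v <= N (x + r *: v) + N x], the value at [r] is at least [N x], the value at 0,
   once [|r|] exceeds [M]. *)
pose M := (N x + N x) / N v.
have M0 : 0 <= M by rewrite divr_ge0// addr_ge0.
have [|r _ rmin] := @EVT_min R f (- M) M _ (continuous_subspaceT cf).
  by lra.
exists r => r'.
have [r'M|] := boolP (r' \in `[- M, M]); first exact: rmin.
rewrite in_itv/= -ler_norml -ltNge ltr_pdivrMr// => /ltW Mr'.
apply: (@le_trans _ _ (f 0)); first by apply: rmin; rewrite in_itv/=; lra.
rewrite /f scale0r addr0.
have := ND (x + r' *: v) (- 1 *: x); rewrite NZ normrN1 mul1r scaleN1r.
by rewrite (addrC x) addrK NZ; lra.
Unshelve. all: by end_near. Qed.

(* Induction on [k]: minimizing [N] along the line spanned by the last vector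
   yields a seminorm, whose minimization involves one vector fewer. *)
Lemma seminorm_span_min (V : lmodType R) (v : nat -> V) (k : nat)
    (N : V -> R) : seminorm N ->
  forall x : V, exists z : nat -> R, forall z' : nat -> R,
    N (x + \sum_(i < k) z i *: v i) <= N (x + \sum_(i < k) z' i *: v i).
Proof.
elim: k N => [|k IH] N sN x.
  by exists (fun=> 0) => z'; rewrite !big_ord0.
have [ND NZ] := sN.
have /choice[r rmin] := fun y => seminorm_line_min sN y (v k).
pose N' y := N (y + r y *: v k).
have N'le y r' : N' y <= N (y + r' *: v k) by exact: rmin.
have N'Z s y : N' (s *: y) <= `|s| * N' y.
  apply: le_trans (N'le _ (s * r y)) _.
  by rewrite -scalerA -scalerDr NZ.
have sN' : seminorm N'.
  split=> [y z|s y].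
    apply: le_trans (N'le _ (r y + r z)) _.
    by rewrite scalerDl addrACA ND.
  (* The reverse inequality is [N'Z] at [s^-1]; for [s = 0] it is nonnegativity. *)
  apply/eqP; rewrite eq_le N'Z/=.
  have [->|s0] := eqVneq s 0.
    by rewrite normr0 mul0r; exact: (seminorm_ge0 sN).
  have := N'Z s^-1 (s *: y); rewrite scalerA mulVf// scale1r normfV.
  by rewrite mulrC ler_pdivlMr ?normr_gt0// mulrC.
have [z zmin] := IH N' sN' x.
(* The last coefficient is the best step along [v k] from the point that minimizes [N']. *)
pose s := r (x + \sum_(i < k) z i *: v i).
exists (fun i => if (i < k)%N then z i else s) => z'.
rewrite !big_ord_recr/= ltnn !addrA.
rewrite (eq_bigr (fun i : 'I_k => z i *: v i)); last first.
  by move=> i _; rewrite ltn_ord.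
exact: le_trans (zmin z') (N'le _ _).
Qed.

(** The extra coordinate homogenizes: fixed to 1, it presents an affine family as a slice of a
    vector space carrying a seminorm. *)
Lemma seminorm_row_min (n : nat) (N : R^o * 'rV[R]_n -> R) : seminorm N ->
  exists z : 'rV[R]_n, forall z', N (1, z) <= N (1, z').
Proof.
move=> sN.
have insub_val (i : 'I_n) : insub (i : nat) = Some i := valK i.
(* The first component is 0, so combinations added to [(1, 0)] stay in the slice; the default 0 is
   never reached for indices below [n]. *)
pose v (i : nat) : R^o * 'rV[R]_n :=
  (0, if insub i is Some j then delta_mx 0 j else 0).
have vE (z : nat -> R) :
    (1, 0) + \sum_(i < n) z i *: v i = (1, \row_i z i) :> R^o * 'rV[R]_n.
  rewrite [RHS]surjective_pairing/= (row_sum_delta (\row_i z i)).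
  congr pair.
    rewrite raddf_sum/= big1 ?addr0// => i _.
    by rewrite scaler0.
  rewrite raddf_sum/= add0r; apply: eq_bigr => i _.
  by rewrite mxE insub_val.
have [z zmin] := seminorm_span_min v n sN (1, 0).
exists (\row_i z i) => z'.
pose w (i : nat) := if insub i is Some j then z' 0 j else 0.
have := zmin w; rewrite !vE; suff -> : \row_i w i = z' by [].
by apply/rowP => i; rewrite mxE /w insub_val.
Qed.

End seminorm.

(** * The [L1] seminorm of real functions *)

Section integral_abs.
Context d (T : measurableType d) (R : realType).
Variable mu : {measure set T -> \bar R}.
Implicit Types (D S : set T) (f g k : T -> R).

Local Notation L1 D f := (\int[mu]_(u in D) `|f u|%:E)%E.

Lemma measurable_absE D f :
  measurable_fun D f -> measurable_fun D (fun u => `|f u|%:E).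
Proof.
by move=> mf; apply/measurable_EFinP; exact: measurableT_comp.
Qed.

Lemma integral_abs_ge0 D f : (0 <= L1 D f)%E.
Proof. by apply: integral_ge0 => u _; rewrite lee_fin. Qed.

Lemma integral_abs_fin D f : (L1 D f < +oo)%E -> exists r : R, L1 D f = r%:E.
Proof.
move=> foo; exists (fine (L1 D f)); rewrite fineK// ge0_fin_numE//.
exact: integral_abs_ge0.
Qed.

Lemma ae_eq_integral_absE D f g : measurable D ->
  measurable_fun D f -> measurable_fun D g -> ae_eq mu D f g ->
  L1 D f = L1 D g.
Proof.
move=> mD mf mg fg; apply: ae_eq_integral => //.
- exact: measurable_absE.
- exact: measurable_absE.
- by apply: filterS fg => u /= fg Du; rewrite fg.
Qed.

Lemma le_integral_absD D f g k : measurable D ->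
  measurable_fun D f -> measurable_fun D g -> measurable_fun D k ->
  (forall u, D u -> `|f u| <= `|g u| + `|k u|) ->
  (L1 D f <= L1 D g + L1 D k)%E.
Proof.
move=> mD mf mg mk fgk.
rewrite -ge0_integralD//; try exact: measurable_absE.
apply: ge0_le_integral => //.
- exact: measurable_absE.
- by apply: emeasurable_funD; exact: measurable_absE.
Qed.

Lemma integral_absZ D (r : R) f : measurable D -> measurable_fun D f ->
  (\int[mu]_(u in D) `|r * f u|%:E = `|r|%:E * L1 D f)%E.
Proof.
move=> mD mf; rewrite -ge0_integralZl//; last exact: measurable_absE.
by apply: eq_integral => u _; rewrite normrM EFinM.
Qed.

Lemma integral_absID D S f : measurable D -> measurable S -> S `<=` D ->
  measurable_fun D f -> L1 D f = (L1 S f + L1 (D `\` S) f)%E.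
Proof.
move=> mD mS SD mf; rewrite -{1}(setDUK SD) ge0_integral_setU//.
- exact: measurableD.
- by rewrite setDUK//; exact: measurable_absE.
- by apply/disj_setPS => u [Su []].
Qed.

Lemma integral_abs0 D f : (forall u, D u -> f u = 0) -> L1 D f = 0%E.
Proof. by move=> f0; apply: integral0_eq => u Du; rewrite f0// normr0. Qed.

(* The l1-norm argument behind the nullspace property: [f] vanishes off [S],
   and [g - f] carries less than half of its mass on [S]. *)
Lemma integral_abs_lt D S f g : measurable D -> measurable S -> S `<=` D ->
  measurable_fun D f -> measurable_fun D g ->
  (forall u, (D `\` S) u -> f u = 0) ->
  (L1 D f < +oo)%E -> (L1 D g < +oo)%E ->
  (\int[mu]_(u in S) `|g u - f u|%:E <
   2^-1%:E * \int[mu]_(u in D) `|g u - f u|%:E)%E ->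
  (L1 D f < L1 D g)%E.
Proof.
move=> mD mS SD mf mg f0 foo goo.
have mDS : measurable (D `\` S) by exact: measurableD.
have mgf : measurable_fun D (g \- f) by exact: measurable_funB.
have mfS := measurable_funS mD SD mf; have mgS := measurable_funS mD SD mg.
have mgfS := measurable_funS mD SD mgf.
have le0 := integral_abs_ge0.
(* Splits a finite sum of nonnegative extended reals into real terms, so that the end is linear
   arithmetic. *)
have fin3 a e : (0 <= a -> 0 <= e -> a + e < +oo ->
    exists r s : R, a = r%:E /\ e = s%:E)%E.
  by move: a e => [a||] [e||]//= _ _ _; exists a, e.
have gfoo : (\int[mu]_(u in D) `|(g \- f) u|%:E < +oo)%E.
  apply: le_lt_trans (lte_add_pinfty goo foo).
  by apply: le_integral_absD => // u _; exact: ler_normB.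
have key : (L1 S f <= L1 S g + L1 S (g \- f))%E.
  apply: le_integral_absD => // u _ /=.
  by rewrite -[X in `|X| <= _](subKr (g u)) (le_trans (ler_normB _ _)).
have gE : L1 (D `\` S) (g \- f) = L1 (D `\` S) g.
  by apply: eq_integral => u /[!inE] uDS /=; rewrite f0// subr0.
rewrite -[X in (_ < _ * X)%E -> _]/(L1 D (g \- f)) in gfoo *.
rewrite -[X in (X < _)%E -> _]/(L1 S (g \- f)).
move: foo goo gfoo; rewrite !(integral_absID mD mS SD)// gE.
rewrite (integral_abs0 f0).
move=> /fin3[//|//|p [z [pE zE]]] /fin3[//|//|q [e [qE eE]]].
move=> /fin3[//|//|r [e' [rE _]]].
(* Here [p], [q], [r] are the masses of [f], [g], [g - f] on [S], and [e] is that of [g] off [S]: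
   the hypothesis amounts to [r < e], and [key] is [p <= q + r]. *)
move: key; rewrite pE qE rE eE adde0 -!EFinD -EFinM !lte_fin lee_fin.
lra.
Qed.

End integral_abs.

Lemma integral_abs_seminorm d (T : measurableType d) (R : realType)
    (mu : {measure set T -> \bar R}) (D : set T) (V : lmodType R)
    (F : V -> T -> R) :
  measurable D -> (forall v, measurable_fun D (F v)) ->
  (forall v, (\int[mu]_(u in D) `|F v u|%:E < +oo)%E) ->
  (forall v w u, F (v + w) u = F v u + F w u) ->
  (forall r v u, F (r *: v) u = r * F v u) ->
  seminorm (fun v => fine (\int[mu]_(u in D) `|F v u|%:E)).
Proof.
move=> mD mF Foo FD FZ; split=> [v w|r v].
- have : (\int[mu]_(u in D) `|F (v + w) u|%:E <=
      \int[mu]_(u in D) `|F v u|%:E + \int[mu]_(u in D) `|F w u|%:E)%E.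
    by apply: le_integral_absD => // u _; rewrite FD ler_normD.
  have [q ->] := integral_abs_fin (Foo (v + w)).
  have [r ->] := integral_abs_fin (Foo v).
  have [e ->] := integral_abs_fin (Foo w).
  by rewrite -EFinD lee_fin.
- have -> : (\int[mu]_(u in D) `|F (r *: v) u|%:E =
      \int[mu]_(u in D) `|r * F v u|%:E)%E.
    by apply: eq_integral => u _; rewrite FZ.
  rewrite integral_absZ//.
  by have [q ->] := integral_abs_fin (Foo v).
Qed.

Section dotp.
Variables (R : realType) (k : nat).
Implicit Types u v w : 'cV[R]_k.

Lemma dotpDr u v w : dotp u (v + w) = dotp u v + dotp u w.
Proof. by rewrite /dotp mulmxDr mxE. Qed.

Lemma dotpZr u r v : dotp u (r *: v) = r * dotp u v.
Proof. by rewrite /dotp -scalemxAr mxE. Qed.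

Lemma dotpBr u v w : dotp u (v - w) = dotp u v - dotp u w.
Proof. by rewrite dotpDr -scaleN1r dotpZr mulN1r. Qed.

End dotp.

(** * The hinge-loss problem, the nullspace property and exact recovery *)

Section recovery.
Variables (R : realType) (m n p : nat) (P : probability (borel_cV R m) R).
Variables (A : 'M[R]_(m, n)) (b c : 'cV[R]_n).
Variables (U : 'M[R]_(n, p)) (h : 'cV[R]_p) (eps : R).
Local Notation Xi := (supp P).
Implicit Types (x y : 'cV[R]_n) (a s : borel_cV R m -> R) (t : R).

Local Notation slope x := (fun u => dotp u (A *m x) - dotp b x).
Local Notation feasible := (hinge_feasible P A b c U h).
Local Notation optimal := (hinge_optimal P A b c U h).
Local Notation mostly_zero := (mostly_zero P eps).
Local Notation NSP := (nullspace_property P A b c U eps).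

Let mXi : measurable Xi := measurable_supp P.

Lemma residualD a x y (u : borel_cV R m) :
  residual A b a (x + y) u = residual A b a x u + (slope y) u.
Proof. by rewrite /residual mulmxDr !dotpDr; ring. Qed.

Lemma measurable_slope x : measurable_fun Xi (slope x).
Proof.
apply: measurable_funB => //.
by apply: measurable_funTS; exact: measurable_dotp.
Qed.

Lemma measurable_residual a x :
  measurable_fun Xi a -> measurable_fun Xi (residual A b a x).
Proof.
move=> ma; apply: measurable_funB => //; apply: measurable_funD => //.
by apply: measurable_funTS; exact: measurable_dotp.
Qed.

Lemma feasible_residual t a x : measurable_fun Xi a ->
  U^T *m x = h -> dotp c x = t -> feasible t a x (residual A b a x).
Proof.
by move=> ma Ux cx; split => //; [exact: measurable_residual|exact: ae_eq_refl].
Qed.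

Lemma mean_abs_feasible t a x s : measurable_fun Xi a ->
  feasible t a x s -> mean_abs P s = mean_abs P (residual A b a x).
Proof.
move=> ma [ms _ rs _]; apply: ae_eq_integral_absE => //.
  exact: measurable_residual.
exact: ae_eq_sym.
Qed.

Lemma feasible_null_pair t a x s x' s' : feasible t a x s ->
  feasible t a x' s' -> null_pair P A b c U (x' - x) (s' \- s).
Proof.
move=> [ms Ux rs cx] [ms' Ux' rs' cx']; split.
- exact: measurable_funB.
- apply: filterS2 rs rs' => u /= rs rs' Xu; rewrite -rs// -rs'//.
  have := residualD a x (x' - x) u; rewrite (addrC x) subrK => ->.
  by rewrite (addrC (residual _ _ _ _ _)) addrK subrr.
- by rewrite dotpBr cx cx' subrr.
- by rewrite mulmxBr Ux Ux' subrr.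
Qed.

Lemma probability_suppD (S : set (borel_cV R m)) :
  measurable S -> S `<=` Xi -> (P (Xi `\` S) = 1 - P S)%E.
Proof.
move=> mS SX; rewrite measureD//; last by rewrite (le_lt_trans (probability_le1 _ _)) ?ltry.
by rewrite (setIidr SX); congr (_ - _)%E; exact: probability_supp.
Qed.

Lemma measurable_zeros s :
  measurable_fun Xi s -> measurable (Xi `&` [set u | s u = 0]).
Proof. by move=> ms; exact: (ms mXi [set 0] (measurable_set1 0)). Qed.

(** The part of the support where [s] is nonzero has probability at most [eps]; the nullspace
    property for [s' - s] on it is what [integral_abs_lt] requires. *)
Lemma nullspace_lt t a x s x' s' : NSP ->
  feasible t a x s -> mostly_zero s -> feasible t a x' s' ->
  (mean_abs P s < +oo)%E -> (mean_abs P s' < +oo)%E ->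
  ae_eq P Xi s' s \/ (mean_abs P s < mean_abs P s')%E.
Proof.
move=> nsp fs zs fs' soo s'oo.
have [ss'|ss'] := pselect (ae_eq P Xi s' s); [by left|right].
have [ms _ _ _] := fs; have [ms' _ _ _] := fs'.
pose Z := Xi `&` [set u | s u = 0].
have mZ : measurable Z by exact: measurable_zeros.
apply: (@integral_abs_lt _ _ _ P Xi (Xi `\` Z)) => //.
- exact: measurableD.
- move=> u [Xu]; apply: contra_notP => su; split=> // -[_ //].
apply: (nsp _ _ (feasible_null_pair fs fs')).
- apply: contra_not ss' => ss'; apply: filterS ss' => u /= ss' Xu.
  by apply/eqP; rewrite -subr_eq0 ss'.
- exact: measurableD.
- by move=> u [].
- rewrite probability_suppD//; last by move=> u [].
  move: zs; rewrite /Defs.mostly_zero -/Z.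
  by rewrite -(fineK (fin_num_measure P Z mZ)) -EFinB !lee_fin; lra.
Qed.

Lemma ae_eq_mostly_zero s s' : measurable_fun Xi s -> measurable_fun Xi s' ->
  ae_eq P Xi s s' -> mostly_zero s -> mostly_zero s'.
Proof.
move=> ms ms' [N [mN N0 ss']]; rewrite /Defs.mostly_zero => /le_trans; apply.
have mZ' := measurable_zeros ms'.
rewrite -(measureU0 mZ' mN N0); apply: le_measure; rewrite ?inE.
- exact: measurable_zeros.
- exact: measurableU.
- move=> u [Xu su]; have [eu|] := pselect (Xi u -> s u = s' u).
    by left; split=> //=; rewrite -eu.
  by move=> /ss'; right.
Qed.

(* On the affine space of feasible points the objective is [N (1, z)] for the
   seminorm [N (r, z) := E |r * residual + slope|]. *)
Lemma hinge_attained t a x : measurable_fun Xi a -> hinge_finite P A b c U h t a ->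
  U^T *m x = h -> dotp c x = t -> exists x', optimal t a x' (residual A b a x').
Proof.
move=> ma foo Ux cx; have fx := feasible_residual ma Ux cx.
(* The rows of [kermx M] span the vectors orthogonal to [c] and to the columns of [U], so [K]
   parametrizes the directions that keep both constraints. *)
pose M := row_mx c U; pose K (z : 'rV[R]_n) := (z *m kermx M)^T.
have KM z : (K z)^T *m M = 0 by rewrite trmxK -mulmxA mulmx_ker mulmx0.
have tr0 q (B : 'M[R]_(n, q)) y : (y^T *m B == 0) = (B^T *m y == 0).
  by rewrite -(inj_eq trmx_inj) trmx_mul trmxK trmx0.
have cK z : dotp c (K z) = 0.
  have /(congr1 lsubmx) := KM z; rewrite mul_mx_row row_mxKl linear0 => /eqP.
  by rewrite tr0 /dotp => /eqP ->; rewrite mxE.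
have UK z : U^T *m K z = 0.
  have /(congr1 rsubmx) := KM z; rewrite mul_mx_row row_mxKr linear0 => /eqP.
  by rewrite tr0 => /eqP.
have fK z : feasible t a (x + K z) (residual A b a (x + K z)).
  apply: feasible_residual => //; first by rewrite mulmxDr UK addr0.
  by rewrite dotpDr cK addr0.
pose F (v : R^o * 'rV[R]_n) u := (v.1 : R) * residual A b a x u + (slope (K v.2)) u.
have mF v : measurable_fun Xi (F v).
  apply: measurable_funD; last exact: measurable_slope.
  by apply: measurable_funM => //; exact: measurable_residual.
(* [F v] is [v.1 - 1] times the residual at [x] plus the residual at [x + K v.2], which reduces
   finiteness to that of two feasible functions. *)
have Foo v : (mean_abs P (F v) < +oo)%E.
  have [r rE] := integral_abs_fin (foo _ _ fx).
  have [e eE] := integral_abs_fin (foo _ _ (fK v.2)).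
  apply: (@le_lt_trans _ _
      (\int[P]_(u in Xi) `|((v.1 : R) - 1) * residual A b a x u|%:E +
       mean_abs P (residual A b a (x + K v.2)))%E).
    apply: le_integral_absD => //.
    - by apply: measurable_funM => //; exact: measurable_residual.
    - exact: measurable_residual.
    - move=> u _; have -> : F v u =
          ((v.1 : R) - 1) * residual A b a x u + residual A b a (x + K v.2) u.
        by rewrite residualD /F mulrBl mul1r -addrA addKr.
      exact: ler_normD.
  rewrite integral_absZ//; last exact: measurable_residual.
  by rewrite rE /mean_abs eE -EFinM -EFinD ltry.
have sF : seminorm (fun v => fine (mean_abs P (F v))).
  apply: integral_abs_seminorm => // [v w u|r v u]; rewrite /F /=.
    by rewrite /K mulmxDl linearD/= mulmxDr !dotpDr; ring.
  rewrite /K -scalemxAl linearZ/= -scalemxAr !dotpZr.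
  have distr (q e f g : R) : r * q * e + (r * f - r * g) = r * (q * e + (f - g)).
    by ring.
  exact: distr.
have [z zmin] := seminorm_row_min sF.
have FE z' : F (1, z') = residual A b a (x + K z').
  by apply/funext => u; rewrite residualD /F mul1r.
exists (x + K z); split=> [//|x' s' fx'].
(* Conversely, every feasible point is [x + K z'] for some [z']. *)
have /submxP : ((x' - x)^T <= kermx M)%MS.
  apply/sub_kermxP.
  have [_ Ux' _ cx'] := fx'.
  apply/eqP; rewrite mul_mx_row row_mx_eq0 (tr0 _ c) (tr0 _ U).
  rewrite [X in _ && (X == _)]mulmxBr Ux Ux' subrr eqxx.
  rewrite andbT; apply/eqP/matrixP => i j.
  by rewrite !ord1 [LHS](dotpBr c x' x) cx cx' subrr mxE.
move=> [z' /(congr1 trmx)]; rewrite trmxK -/(K z') => x'E.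
have {}x'E : x' = x + K z' by rewrite -x'E addrC subrK.
rewrite (mean_abs_feasible ma fx') x'E -(FE z) -(FE z').
have fineN v : (fine (mean_abs P (F v)))%:E = mean_abs P (F v).
  by have [r] := integral_abs_fin (Foo v); rewrite /mean_abs => ->.
rewrite -(fineN (1, z)) -(fineN (1, z')) lee_fin.
exact: zmin.
Qed.

(** Were the two functions different, [nullspace_lt] would make [s] strictly better than the
    minimizer [s']. *)
Lemma nullspace_exact_recovery : NSP -> exact_recovery P A b c U h eps.
Proof.
move=> nsp t a ma foo x s fs zs x' s' [fs' s'min].
have [ss'|] := nullspace_lt nsp fs zs fs' (foo _ _ fs) (foo _ _ fs').
  split=> //; have [ms _ _ _] := fs; have [ms' _ _ _] := fs'.
  by apply: ae_eq_mostly_zero zs => //; exact: ae_eq_sym.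
by rewrite ltNge (s'min _ _ fs).
Qed.

(* If [s] has half of its mass on [S], choose [a] so that the residual is
   [s1 = - s 1_S] at [x0] and [s2 = s 1_(~S)] at [x0 + x].  The former vanishes
   often enough to be the recovered function, yet the latter is at least as
   good. *)
Lemma exact_recovery_nullspace : (exists x, U^T *m x = h) ->
  (forall x s, null_pair P A b c U x s -> (mean_abs P s < +oo)%E) ->
  exact_recovery P A b c U h eps -> NSP.
Proof.
move=> [x0 Ux0] foo rec x s nxs s0 S mS SX Seps.
rewrite ltNge; apply/negP => half.
have [ms rs cx Ux] := nxs.
pose s1 (u : borel_cV R m) := - (s u * \1_S u).
pose s2 (u : borel_cV R m) := s u + s1 u.
have mindic : measurable_fun Xi (\1_S : borel_cV R m -> R).
  exact: measurable_indic.
have ms1 : measurable_fun Xi s1.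
  by apply: measurableT_comp => //; apply: measurable_funM.
have ms2 : measurable_fun Xi s2 by exact: measurable_funD.
have s1S u : S u -> s1 u = - s u.
  by move=> Su; rewrite /s1 indicE mem_set// mulr1.
have s1NS u : ~ S u -> s1 u = 0.
  by move=> Su; rewrite /s1 indicE memNset// mulr0 oppr0.
pose a u := s1 u - (slope x0) u.
have ma : measurable_fun Xi a.
  by apply: measurable_funB => //; exact: measurable_slope.
have r1 : residual A b a x0 = s1.
  by apply/funext => u; rewrite /residual /a; ring.
have f1 : feasible (dotp c x0) a x0 s1.
  by rewrite -r1; exact: feasible_residual.
have f2 : feasible (dotp c x0) a (x0 + x) s2.
  split=> //; first by rewrite mulmxDr Ux addr0.
  - apply: filterS rs => u /= rs Xu; rewrite residualD r1 /s2 addrC.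
    by congr (_ + _); apply/eqP; rewrite -subr_eq0 rs.
  - by rewrite dotpDr cx addr0.
have mXS : measurable (Xi `\` S) by exact: measurableD.
have msS := measurable_funS mXi SX ms.
have E1 : mean_abs P s1 = (\int[P]_(u in S) `|s u|%:E)%E.
  rewrite /mean_abs (integral_absID P mXi mS SX ms1).
  rewrite [X in (_ + X)%E]integral_abs0 ?adde0; last by move=> u [_ /s1NS].
  by apply: eq_integral => u /[!inE] Su; rewrite s1S// normrN.
have E2 : mean_abs P s2 = (\int[P]_(u in Xi `\` S) `|s u|%:E)%E.
  rewrite /mean_abs (integral_absID P mXi mS SX ms2).
  rewrite [X in (X + _)%E]integral_abs0 ?add0e; last first.
    by move=> u /s1S; rewrite /s2 => ->; rewrite subrr.
  apply: eq_integral => u /[!inE] -[_ Su].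
  by rewrite /s2 s1NS// addr0.
(* At least half of the mass of [s] lies on [S], so no more lies off [S] than on it. *)
have E21 : (mean_abs P s2 <= mean_abs P s1)%E.
  move: half (foo _ _ nxs); rewrite E1 E2 /mean_abs.
  rewrite (integral_absID P mXi mS SX ms).
  have := integral_abs_ge0 P S s; have := integral_abs_ge0 P (Xi `\` S) s.
  move: (\int[P]_(u in S) _)%E (\int[P]_(u in Xi `\` S) _)%E.
  move=> [q||] [r||]//= _ _ + _; rewrite -EFinD -EFinM !lee_fin; lra.
have E1oo : (mean_abs P s1 < +oo)%E.
  rewrite E1; apply: le_lt_trans (foo _ _ nxs).
  rewrite /mean_abs (integral_absID P mXi mS SX ms) leeDl//.
  exact: integral_abs_ge0.
(* A feasible function is [s1] plus the function of a null pair, and both are integrable. *)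
have hfin : hinge_finite P A b c U h (dotp c x0) a.
  move=> x' s' fs'; have := foo _ _ (feasible_null_pair f1 fs') => doo.
  apply: le_lt_trans (lte_add_pinfty doo E1oo).
  have [ms' _ _ _] := fs'.
  apply: le_integral_absD => //; first exact: measurable_funB.
  by move=> u _ /=; rewrite -[X in `|X| <= _](subrK (s1 u)) ler_normD.
have z1 : mostly_zero s1.
  apply: (@le_trans _ _ (P (Xi `\` S))).
    rewrite probability_suppD//.
    by rewrite EFinB leeB.
  apply: le_measure; rewrite ?inE//; first exact: measurable_zeros.
  by move=> u [Xu /s1NS].
(* Recovery identifies an existing minimizer with [s1]; hence [s1] has the minimal value, and so has
   [s2], which is no worse. *)
have [x' opt'] := hinge_attained ma hfin Ux0 erefl.
have [s'1 _] := rec _ _ ma hfin _ _ f1 z1 _ _ opt'.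
have opt2 : optimal (dotp c x0) a (x0 + x) s2.
  split=> // x'' s'' f''; apply: le_trans E21 _.
  have [[ms' _ _ _] min'] := opt'.
  rewrite /mean_abs -(ae_eq_integral_absE mXi ms' ms1 s'1); exact: (min' _ _ f'').
have [s21 _] := rec _ _ ma hfin _ _ f1 z1 _ _ opt2.
(* Recovery for [s2] gives [s2 = s1] almost everywhere, and their difference is [s], which was
   assumed nonzero. *)
apply: s0; apply: filterS s21 => u /= s21 Xu.
by have := s21 Xu; rewrite /s2 -[RHS]add0r => /addIr.
Qed.

(** * The chance constrained program and ALSO-X *)

Lemma residual_zeros a x :
  [set u | residual A b a x u = 0] = [set u | dotp u (A *m x) + a u = dotp b x].
Proof.
apply/seteqP; split=> u /=; rewrite /residual.
  by move=> /eqP; rewrite subr_eq0 => /eqP.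
by move=> ->; rewrite subrr.
Qed.

Lemma ccp_feasible_hinge a x : measurable_fun Xi a ->
  ccp_feasible P A b U h eps a x ->
  feasible (dotp c x) a x (residual A b a x) /\ mostly_zero (residual A b a x).
Proof.
move=> ma [Ux zx]; split; first exact: feasible_residual.
by rewrite /Defs.mostly_zero residual_zeros.
Qed.

Lemma hinge_ccp_feasible t a x s : measurable_fun Xi a ->
  feasible t a x s -> mostly_zero s -> ccp_feasible P A b U h eps a x.
Proof.
move=> ma [ms Ux rs _] zs; split=> //.
have := ae_eq_mostly_zero ms (measurable_residual x ma) (ae_eq_sym rs) zs.
by rewrite /Defs.mostly_zero residual_zeros.
Qed.

Lemma nullspace_optimal t a x s : NSP -> measurable_fun Xi a ->
  hinge_finite P A b c U h t a -> feasible t a x s -> mostly_zero s ->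
  optimal t a x s.
Proof.
move=> nsp ma foo fs zs; split=> // x' s' fs'.
have [ss'|/ltW//] := nullspace_lt nsp fs zs fs' (foo _ _ fs) (foo _ _ fs').
have [ms _ _ _] := fs; have [ms' _ _ _] := fs'.
by rewrite /mean_abs (ae_eq_integral_absE mXi ms' ms ss').
Qed.

(** The residual of a chance-constrained optimum is hinge-optimal for [t = v], so [v] is attained;
    conversely each ALSO-X value is the cost of a chance-feasible point, so [v] is a lower bound. *)
Lemma nullspace_alsox_exact a v : NSP -> measurable_fun Xi a ->
  (forall t, hinge_finite P A b c U h t a) ->
  is_min (ccp_values P A b c U h eps a) v ->
  is_min (alsox_values P A b c U h eps a) v.
Proof.
move=> nsp ma foo [[x fx <-] vmin]; split.
  have [fs zs] := ccp_feasible_hinge ma fx.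
  by exists x, (residual A b a x); split=> //; exact: nullspace_optimal.
move=> t [x' [s' [[fs' _] zs']]]; have [_ _ _ <-] := fs'.
by apply: vmin; exists x' => //; exact: hinge_ccp_feasible fs' zs'.
Qed.

(** Optimal points have equal cost, hence are feasible for the same hinge-loss problem, where
    recovery applies to their residuals. *)
Lemma nullspace_ccp_residual_unique a x1 x2 : NSP -> measurable_fun Xi a ->
  (forall t, hinge_finite P A b c U h t a) ->
  ccp_optimal P A b c U h eps a x1 -> ccp_optimal P A b c U h eps a x2 ->
  ae_eq P Xi (residual A b a x1) (residual A b a x2).
Proof.
move=> nsp ma foo [fx1 min1] [fx2 min2].
have [f1 z1] := ccp_feasible_hinge ma fx1.
have [f2 z2] := ccp_feasible_hinge ma fx2.
have c12 : dotp c x1 = dotp c x2.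
  by apply/le_anti/andP; split; [apply: min1; exists x2|apply: min2; exists x1].
rewrite c12 in f1.
by have [] := nullspace_exact_recovery nsp ma (foo _) f2 z2
  (nullspace_optimal nsp ma (foo _) f1 z1).
Qed.

End recovery.

Theorem theorem2 (R : realType) (d : measure_display) (T : measurableType d)
    (Pr : probability T R) (m n p : nat) (xi : {RV Pr >-> borel_cV R m})
    (A : 'M[R]_(m, n)) (b c : 'cV[R]_n) (U : 'M[R]_(n, p)) (h : 'cV[R]_p)
    (eps : R) (heps : 0 < eps < 1)
    (hX : exists x : 'cV[R]_n, U^T *m x = h)
    (hfin : forall x s, null_pair (distribution Pr xi) A b c U x s ->
      (mean_abs (distribution Pr xi) s < +oo)%E) :
  (nullspace_property (distribution Pr xi) A b c U eps <->
   exact_recovery (distribution Pr xi) A b c U h eps)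
  /\
  (nullspace_property (distribution Pr xi) A b c U eps ->
   forall a : borel_cV R m -> R,
     measurable_fun (supp (distribution Pr xi)) a ->
     (forall t, hinge_finite (distribution Pr xi) A b c U h t a) ->
   forall vstar : R,
     is_min (ccp_values (distribution Pr xi) A b c U h eps a) vstar ->
     is_min (alsox_values (distribution Pr xi) A b c U h eps a) vstar /\
     forall x1 x2 : 'cV[R]_n,
       ccp_optimal (distribution Pr xi) A b c U h eps a x1 ->
       ccp_optimal (distribution Pr xi) A b c U h eps a x2 ->
       ae_eq (distribution Pr xi) (supp (distribution Pr xi))
         (residual A b a x1) (residual A b a x2)).
Proof.
split; first by split;
  [exact: nullspace_exact_recovery|exact: exact_recovery_nullspace].
move=> nsp a ma foo v vmin; split; first exact: nullspace_alsox_exact.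
by move=> x1 x2; exact: nullspace_ccp_residual_unique.
Qed.
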